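(* Let $X$ be a nonempty set and $\tau$ a nonempty family of subsets of $X$. If $|X|=\omega$, then the Lindelöf ordinal of $(X,\tau)$ is either $\omega_1$, or is $\le\omega\cdot\omega$. More generally, if $\kappa$ is an infinite regular cardinal and $|X|=\kappa$, then the Lindelöf ordinal of $(X,\tau)$ cannot have the form $\alpha_1+\kappa^{\varepsilon}+\gamma$ with $\alpha_1\geq 0$, $0<\gamma<\kappa\cdot\omega$, and $\varepsilon>1$ such that $\varepsilon$ is either a successor ordinal or $\operatorname{cf}\varepsilon=\kappa$.
   Context: For a nonempty set $X$, a nonempty family $\tau$ of subsets of $X$ (not necessarily a topology) and nonzero ordinals $\alpha,\beta$, $(X,\tau)$ is $[\beta,\alpha]$-compact if, whenever $(O_\delta)_{\delta\in\alpha}$ is a sequence of members of $\tau$ (repetitions allowed) with $\bigcup_{\delta\in\alpha}O_\delta=X$, there is $H\subseteq\alpha$ of order type $<\beta$ (in the induced order) with $\bigcup_{\delta\in H}O_\delta=X$. $(X,\tau)$ is $[\beta,\infty)$-compact if it is $[\beta,\alpha]$-compact for all ordinals $\alpha\ge\beta$. The Lindelöf ordinal of $(X,\tau)$ is the smallest nonzero ordinal $\alpha$ such that $(X,\tau)$ is $[\alpha,\infty)$-compact. The operations $+$, $\cdot$ and exponentiation are ordinal operations; cardinals are identified with initial ordinals; the Axiom of Choice is assumed. *)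

(* Defs.v *)
From HB Require Import structures.
From mathcomp Require Import all_boot all_order generic_quotient.
From mathcomp Require Import boolp wochoice classical_sets functions cardinality.
Set Implicit Arguments.
Unset Strict Implicit.
Unset Printing Implicit Defensive.
Import Order.TTheory.
Local Open Scope quotient_scope.
Local Open Scope classical_set_scope.
Local Open Scope card_scope.
Local Open Scope order_scope.

Declare Scope ord_scope.
Delimit Scope ord_scope with ord.

(** Ordinals.  [onode f] denotes the least ordinal strictly above all the
    [f i]; ordinals are these trees up to the induced preorder, so that equality
    on [Ord] is Leibniz equality.  The lemmas [lt_Ord_wf], [Ord_strict_sup],
    [below_small] and [well_order_type] show that [Ord] is a well-ordered class
    of which the proper initial segments are exactly, up to isomorphism, the
    well-ordered types (of the universe of [I]). *)
Inductive otree : Type := onode (I : Type) (f : I -> otree).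

Fixpoint ole (a b : otree) : Prop :=
  match a, b with
  | @onode A f, @onode B g => forall i, exists j, ole (f i) (g j)
  end.

Definition olt (a b : otree) : Prop :=
  match b with @onode B g => exists j, ole a (g j) end.

Lemma ole_refl a : ole a a.
Proof. by elim: a => I f IH i; exists i; apply: IH. Qed.

Lemma ole_trans a b c : ole a b -> ole b c -> ole a c.
Proof.
elim: a b c => I f IH [J g] [K h] /= ab bc i.
have [j fg] := ab i; have [k gh] := bc j.
by exists k; apply: IH fg gh.
Qed.

Lemma ole_nodeP I (f : I -> otree) b : ole (onode f) b <-> forall i, olt (f i) b.
Proof. by case: b. Qed.

Lemma ole_total a b : ole a b \/ olt b a.
Proof.
elim: a b => I f IH; elim=> J g IHg.
have [|nab] := pselect (ole (onode f) (onode g)); [by left | right].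
move: nab => /= /existsNP [i] /forallNP nfg; exists i.
by apply/ole_nodeP => j; case: (IH i (g j)) => // /nfg.
Qed.

Lemma olt_le_trans a b c : olt a b -> ole b c -> olt a c.
Proof.
case: b c => J g [K h] /= [j ag] /(_ j)[k gh].
by exists k; apply: ole_trans gh.
Qed.

Lemma olt_irr a : ~ olt a a.
Proof.
elim: a => I f IH [i afi]; apply: (IH i).
by apply: olt_le_trans afi; exists i; apply: ole_refl.
Qed.

Lemma oltNle a b : olt a b <-> ~ ole b a.
Proof.
split=> [ab ba|nba]; first exact: (olt_irr (olt_le_trans ab ba)).
by case: (ole_total b a).
Qed.

Lemma olt_wf : well_founded olt.
Proof.
suff H a b : ole b a -> Acc olt b by move=> a; apply: (H a); exact: ole_refl.
elim: a b => I f IH b bf; constructor=> c /olt_le_trans/(_ bf) [i].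
exact: IH.
Qed.

Lemma oltW a b : olt a b -> ole a b.
Proof.
elim: a b => I f IH [J g] [j /ole_nodeP fg] i.
by exists j; apply: IH; apply: fg.
Qed.

HB.instance Definition _ := gen_eqMixin otree.
HB.instance Definition _ := gen_choiceMixin otree.

Definition oeqv (a b : otree) : bool := `[< ole a b /\ ole b a >].

Lemma oeqv_refl : reflexive oeqv.
Proof. by move=> a; apply/asboolP; split; apply: ole_refl. Qed.

Lemma oeqv_sym : symmetric oeqv.
Proof. by move=> a b; apply/asboolP/asboolP => -[]. Qed.

Lemma oeqv_trans : transitive oeqv.
Proof.
move=> b a c /asboolP[ab ba] /asboolP[bc cb].
by apply/asboolP; split; [apply: ole_trans bc | apply: ole_trans ba].
Qed.

Canonical oeqv_equiv := EquivRel oeqv oeqv_refl oeqv_sym oeqv_trans.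

Definition Ord := {eq_quot oeqv}.
HB.instance Definition _ := Choice.on Ord.

Definition le_Ord (a b : Ord) : bool := `[< ole (repr a) (repr b) >].

Lemma le_Ord_refl : reflexive le_Ord.
Proof. by move=> a; apply/asboolP; apply: ole_refl. Qed.

Lemma le_Ord_anti : antisymmetric le_Ord.
Proof.
move=> a b /andP[/asboolP ab /asboolP ba].
rewrite -[a]reprK -[b]reprK; apply/eqP; rewrite eqmodE.
by apply/asboolP.
Qed.

Lemma le_Ord_trans : transitive le_Ord.
Proof. by move=> b a c /asboolP ab /asboolP bc; apply/asboolP/(ole_trans ab). Qed.

Fact Ord_display : Order.disp_t. Proof. exact: Order.Disp. Qed.

HB.instance Definition _ := Order.Le_isPOrder.Build Ord_display Ord
  le_Ord_refl le_Ord_anti le_Ord_trans.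

Lemma le_Ord_total : total (<=%O : rel Ord).
Proof.
move=> a b; apply/orP; have [ab|/oltW ba] := ole_total (repr a) (repr b).
  by left; apply/asboolP.
by right; apply/asboolP.
Qed.

HB.instance Definition _ := Order.POrder_isTotal.Build Ord_display Ord le_Ord_total.

Lemma leOrdE (a b : Ord) : a <= b = `[< ole (repr a) (repr b) >].
Proof. by []. Qed.

Lemma ltOrdE (a b : Ord) : a < b = `[< olt (repr a) (repr b) >].
Proof.
rewrite ltNge leOrdE; apply/idP/asboolP => [/negP nba|/oltNle nba].
  by apply/oltNle => ba; apply/nba/asboolP.
by apply/negP => /asboolP.
Qed.

Lemma ole_pi (t : otree) : ole (repr (\pi_Ord t)) t /\ ole t (repr (\pi_Ord t)).
Proof.
have : \pi_Ord (repr (\pi_Ord t)) == \pi_Ord t by rewrite reprK.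
by rewrite eqmodE => /asboolP.
Qed.

Lemma lt_Ord_wf : well_founded (fun a b : Ord => a < b).
Proof.
suff H t (a : Ord) : repr a = t -> Acc (fun a b : Ord => a < b) a.
  by move=> a; apply: H erefl.
elim: (olt_wf t) a => {}t _ IH a at_; constructor=> b.
by rewrite ltOrdE at_ => /asboolP /IH; apply.
Qed.

Lemma Ord_strict_sup (A : Type) (f : A -> Ord) :
  exists s, forall b, b < s <-> exists i, b <= f i.
Proof.
exists (\pi_Ord (onode (fun i => repr (f i)))) => b.
have [p1 p2] := ole_pi (onode (fun i => repr (f i))).
rewrite ltOrdE; split=> [/asboolP/olt_le_trans/(_ p1)[i bi]|[i bi]].
  by exists i; rewrite leOrdE; apply/asboolP.
apply/asboolP; apply: olt_le_trans p2; exists i.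
by move: bi; rewrite leOrdE => /asboolP.
Qed.

Definition below (a : Ord) : set Ord := [set b | b < a].
Arguments below a _ /.

Fixpoint oidx (t : otree) : Type :=
  match t with @onode A f => {i : A & option (oidx (f i))} end.

Fixpoint opred (t : otree) : oidx t -> otree :=
  match t with
  | @onode A f => fun x =>
    match projT2 x with Some y => @opred (f (projT1 x)) y | None => f (projT1 x) end
  end.

Lemma opredP (t u : otree) :
  olt u t <-> exists x : oidx t, ole u (opred x) /\ ole (opred x) u.
Proof.
elim: t u => A f IH u; split=> [[i ui]|[[i [y|]] /= [uy yu]]].
- have [fu|/IH[y yP]] := ole_total (f i) u.
    by exists (existT _ i None).
  by exists (existT _ i (Some y)).
- by exists i; apply/oltW/IH; exists y.
- by exists i.
Qed.

Lemma below_small (a : Ord) : exists (A : Type) (f : A -> Ord), below a = range f.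
Proof.
exists (oidx (repr a)), (fun x => \pi_Ord (opred x)); apply/seteqP; split=> b /=.
  rewrite ltOrdE => /asboolP /opredP [x xP]; exists x => //.
  by rewrite -[b]reprK; apply/eqP; rewrite eqmodE; apply/asboolP; case: xP.
case=> x _ <-; rewrite /= ltOrdE; apply/asboolP/opredP; exists x.
by case: (ole_pi (opred x)).
Qed.

Lemma collapse (T : Type) (R : T -> T -> Prop) : well_founded R ->
  exists rk : T -> Ord, forall x b, b < rk x <-> exists2 y, R y x & b <= rk y.
Proof.
move=> wfR; pose sup A (f : A -> Ord) := projT1 (cid (Ord_strict_sup f)).
have supP A (f : A -> Ord) b : b < sup A f <-> exists i, b <= f i.
  exact: (projT2 (cid (Ord_strict_sup f))).
pose F x (G : forall y, R y x -> Ord) : Ord :=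
  sup {y | R y x} (fun y => G (proj1_sig y) (proj2_sig y)).
pose rk := Fix wfR (fun=> Ord) F; exists rk => x b.
have -> : rk x = F x (fun y _ => rk y).
  rewrite /rk Fix_eq // => {}x G H GH; congr (F x _).
  by apply: functional_extensionality_dep => y; apply: functional_extensionality_dep.
rewrite supP; split=> [[[y Ryx] /= by_]|[y Ryx by_]]; first by exists y.
by exists (exist _ y Ryx).
Qed.

Definition has_order_type (H : set Ord) (g : Ord) : Prop :=
  exists f : Ord -> Ord,
    (forall x y, x < y -> y < g -> f x < f y) /\ f @` below g = H.

Lemma range_order_type (T : Type) (d : T -> Ord) : exists g h,
  [/\ forall x y : T, (h x < h y :> Ord) = (d x < d y),
      below g = range h & has_order_type (range d) g].
Proof.
have wfR : well_founded (fun x y : T => d x < d y).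
  suff H a x : d x = a -> Acc (fun x y : T => d x < d y) x.
    by move=> x; apply: H erefl.
  elim: (lt_Ord_wf a) x => {}a _ IH x dx; constructor=> y.
  by rewrite dx => /IH; apply.
have [rk rkP] := collapse wfR.
have rk_le x y : d x <= d y -> rk x <= rk y.
  move=> dxy; rewrite leNgt; apply/negP => /rkP[z zx yz].
  have /rkP : exists2 y0, d y0 < d y & rk y <= rk y0.
    by exists z => //; apply: lt_le_trans dxy.
  by rewrite ltxx.
have rk_lt x y : (rk x < rk y) = (d x < d y).
  apply/idP/idP => [|dxy]; last by apply/rkP; exists x.
  by apply: contraTT; rewrite -!leNgt; apply: rk_le.
have rk_eq x y : rk x = rk y -> d x = d y.
  move=> e; apply/eqP; rewrite eq_le !leNgt -!rk_lt e ltxx //.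
have rk_init : forall x b, b < rk x -> exists y, rk y = b.
  move=> x; elim/(well_founded_ind wfR): x => x IH b /rkP[y yx].
  by rewrite le_eqVlt => /orP[/eqP ->|/IH]; [exists y|apply].
have [g gP] := Ord_strict_sup rk.
have gE : below g = range rk.
  apply/seteqP; split=> b /=; last by case=> x _ <-; apply/gP; exists x.
  move/gP => [x]; rewrite le_eqVlt => /orP[/eqP ->|/rk_init[y <-]]; first by exists x.
  by exists y.
exists g, rk; split=> //.
have inv b : exists e, b < g -> exists2 x, rk x = b & d x = e.
  have [bg|] := pselect (b < g); last by exists b.
  have [x _ <-] : range rk b by rewrite -gE.
  by exists (d x) => _; exists x.
have [f fP] := choice inv; exists f; split=> [x y xy yg|].
  have [u ux <-] := fP _ (lt_trans xy yg); have [v vy <-] := fP _ yg.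
  by rewrite -rk_lt ux vy.
apply/seteqP; split=> b /= [x].
  by move=> /fP[y _ yf] <-; exists y.
move=> _ <-; exists (rk x); first by apply/gP; exists x.
have [|y /rk_eq yx <-] := fP (rk x); first by apply/gP; exists x.
by [].
Qed.

Lemma well_order_type (T : Type) (R : rel T) : well_order R ->
  exists (g : Ord) (h : T -> Ord),
    (forall x y, (h x <= h y) = R x y) /\ below g = range h.
Proof.
move=> woR.
have minR (P : T -> Prop) : (exists x, P x) ->
    exists2 z, P z & forall x, P x -> R z x.
  case=> x Px; have [|z [[zP zmin] _]] := woR (fun y => `[< P y >]).
    by exists x; apply/asboolP.
  exists z; first exact/asboolP.
  by move=> y Py; apply: zmin; apply/asboolP.
have refl x : R x x by have [|z -> h] := minR (fun y => y = x); [exists x|apply: h].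
have tot x y : R x y \/ R y x.
  have [|z [->|->] h] := minR (fun z => z = x \/ z = y); first by exists x; left.
    by left; apply: h; right.
  by right; apply: h; left.
have anti x y : R x y -> R y x -> x = y.
  move=> xy yx; have [|z [_ zu]] := woR (fun z => `[< z = x \/ z = y >]).
    by exists x; apply/asboolP; left.
  have mx : minimum_of R (fun z => `[< z = x \/ z = y >]) x.
    split; first by apply/asboolP; left.
    by move=> u /asboolP[->|->].
  have my : minimum_of R (fun z => `[< z = x \/ z = y >]) y.
    split; first by apply/asboolP; right.
    by move=> u /asboolP[->|->].
  by rewrite -(zu _ mx) -(zu _ my).
have trans x y z : R x y -> R y z -> R x z.
  move=> xy yz.
  have [|u u3 h] := minR (fun u => [\/ u = x, u = y | u = z]).
    by exists x; constructor 1.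
  case: u3 => uE; rewrite uE in h.
  - by apply: h; constructor 3.
  - have yx : R y x by apply: h; constructor 1.
    by rewrite (anti _ _ xy yx).
  - have zy : R z y by apply: h; constructor 2.
    by rewrite -(anti _ _ yz zy).
have wfR : well_founded (fun x y => ~ R y x).
  move=> x; apply: contrapT => nacc.
  have [|z nz zmin] := minR (fun x => ~ Acc (fun x y => ~ R y x) x).
    by exists x.
  by apply: nz; constructor=> y nzy; apply: contrapT => /zmin.
have [rk rkP] := collapse wfR.
have rk_lt x y : ~ R y x -> rk x < rk y by move=> nyx; apply/rkP; exists x.
have [g [h [hlt gE _]]] := range_order_type rk.
exists g, h; split=> // x y; rewrite leNgt hlt -leNgt.
apply/idP/idP => [|xy]; last first.
  have [->//|nxy] := pselect (x = y).
  by apply/ltW/rk_lt => yx; apply/nxy/anti.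
by apply: contraTT => /negP/rk_lt; rewrite -ltNge.
Qed.

Lemma Ord_not_injective (X : Type) : exists a : Ord,
  ~ exists f : Ord -> X, forall x y, x < a -> y < a -> f x = f y -> x = y.
Proof.
pose T := X -> Prop.
pose eT : eqType := HB.pack T (gen_eqMixin T).
have [R woR] := well_ordering_principle eT.
have [g [h [hle gE]]] := @well_order_type T R woR.
exists g => -[f finj].
have hg (x : T) : h x < g.
  have : range h (h x) by exists x.
  by rewrite -gE.
have hinj (x y : T) : h x = h y -> x = y.
  move=> hxy; have [|z [_ zu]] := woR (fun z => `[< z = x \/ z = y >]).
    by exists x; apply/asboolP; left.
  have mx : minimum_of R (fun z => `[< z = x \/ z = y >]) x.
    split; first by apply/asboolP; left.
    by move=> u /asboolP[->|->]; rewrite -hle ?hxy.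
  have my : minimum_of R (fun z => `[< z = x \/ z = y >]) y.
    split; first by apply/asboolP; right.
    by move=> u /asboolP[->|->]; rewrite -hle ?hxy.
  by rewrite -(zu _ mx) -(zu _ my).
pose D : T := fun x => exists2 A : T, x = f (h A) & ~ A x.
have [DD|nDD] := pselect (D (f (h D))); last by apply: (nDD); exists D.
have [A /finj e nA] := (DD); move: nA; have -> : A = D by apply/esym/hinj/e.
by apply.
Qed.

Definition ozero : Ord := \pi_Ord (onode (of_void otree)).

Definition oleast (P : set Ord) : Ord := xget ozero [set a | P a /\ lbound P a].

Lemma oleastP (P : set Ord) : P !=set0 ->
  P (oleast P) /\ forall b, P b -> oleast P <= b.
Proof.
move=> [a Pa]; suff: exists x, P x /\ lbound P x by move=> /(xgetPex ozero).
apply: contrapT => /forallNP nP; elim/(well_founded_ind lt_Ord_wf): a Pa => a IH Pa.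
apply: (nP a); split=> // b Pb; rewrite leNgt; apply/negP => /IH; exact.
Qed.

Definition osucc (a : Ord) : Ord := oleast [set b | a < b].

Definition osup (A : set Ord) : Ord := supremum ozero A.

Definition is_succ (a : Ord) : Prop := exists b, a = osucc b.

(** Transfinite recursion with value [z] at [0], step [s] at successors and
    suprema at limits; see [orec0], [orecS] and [orec_lim]. *)
Definition orec_step (z : Ord) (s : Ord -> Ord) (b : Ord)
    (F : forall d, d < b -> Ord) : Ord :=
  if b == ozero then z else
  match pselect (exists d, d < b /\ b = osucc d) with
  | left sb => s (F (projT1 (cid sb)) (projT2 (cid sb)).1)
  | right _ => osup [set c | exists d (db : d < b), c = F d db]
  end.

Definition orec (z : Ord) (s : Ord -> Ord) : Ord -> Ord :=
  Fix lt_Ord_wf (fun=> Ord) (orec_step z s).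

Definition oadd (a : Ord) : Ord -> Ord := orec a osucc.
Definition omul (a : Ord) : Ord -> Ord := orec ozero (fun x => oadd x a).
(* [oexp 0 b] is [0] at successors and [1] at limits. *)
Definition oexp (a : Ord) : Ord -> Ord := orec (osucc ozero) (fun x => omul x a).

Notation "0" := ozero : ord_scope.
Notation "1" := (osucc ozero) : ord_scope.
Notation "a + b" := (oadd a b) : ord_scope.
Notation "a * b" := (omul a b) : ord_scope.
Notation "a ^ b" := (oexp a b) : ord_scope.
Bind Scope ord_scope with Ord.
Local Open Scope ord_scope.

Lemma ole0 (a : Ord) : 0 <= a.
Proof.
rewrite leOrdE; apply/asboolP; have [p _] := ole_pi (onode (of_void otree)).
by apply: ole_trans p _; case: (repr a) => A f [].
Qed.

Lemma osuccP (a b : Ord) : b < osucc a <-> b <= a.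
Proof.
have [|a_lt amin] := @oleastP [set b | a < b].
  have [s sP] := Ord_strict_sup (fun _ : unit => a).
  by exists s => /=; apply/sP; exists tt.
split=> [|ba]; last exact: le_lt_trans a_lt.
by apply: contraTT; rewrite -ltNge -leNgt => /amin.
Qed.

Lemma ltOrdS (a : Ord) : a < osucc a. Proof. exact/osuccP. Qed.

Lemma osucc_le (a b : Ord) : osucc a <= b <-> a < b.
Proof.
split=> [|ab]; first exact/lt_le_trans/ltOrdS.
by rewrite leNgt; apply/negP => /osuccP; rewrite leNgt ab.
Qed.

Lemma osucc_inj : injective osucc.
Proof.
move=> a b e; apply/eqP; rewrite eq_le; apply/andP; split; apply/osuccP.
  by rewrite -e; apply/osuccP.
by rewrite e; apply/osuccP.
Qed.

Lemma osupP (A : set Ord) : ubound A !=set0 ->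
  ubound A (osup A) /\ forall b, ubound A b -> osup A <= b.
Proof.
move=> ubA; have [u ul] := oleastP ubA; rewrite /osup /supremum.
case: ifPn => [/eqP ->|_]; first by split=> // b _; apply: ole0.
have : supremums A (xget 0 (supremums A)) by apply: xgetPex; exists (oleast (ubound A)).
by case.
Qed.

Lemma image_below_bounded (a : Ord) (f : Ord -> Ord) : ubound (f @` below a) !=set0.
Proof.
have [A [g ->]] := below_small a.
have [s sP] := Ord_strict_sup (fun i => f (g i)); exists s => _ [_ [i _ <-] <-].
by apply/ltW/sP; exists i.
Qed.

Lemma orecE z s b : orec z s b = orec_step z s (fun d (_ : d < b) => orec z s d).
Proof.
rewrite /orec Fix_eq // => {}b F G FG; congr (orec_step _ _ _).
by apply: functional_extensionality_dep => d; apply: functional_extensionality_dep.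
Qed.

Lemma orec0 z s : orec z s 0 = z.
Proof. by rewrite orecE /orec_step eqxx. Qed.

Lemma orecS z s b : orec z s (osucc b) = s (orec z s b).
Proof.
have bS : b < osucc b by apply/osuccP.
rewrite orecE /orec_step; case: eqP => [b0|_].
  by have := lt_le_trans bS; rewrite b0 => /(_ b (ole0 b)); rewrite ltxx.
case: pselect => [sb|[]]; last by exists b.
by case: (cid sb) => d [/= _ /osucc_inj ->].
Qed.

Lemma orec_lim z s b : b <> 0 -> ~ is_succ b ->
  orec z s b = osup [set orec z s d | d in below b].
Proof.
move=> b0 nsb; rewrite orecE /orec_step; case: eqP => // _.
case: pselect => [sb|_]; first by case: nsb; case: sb => d [_ ->]; exists d.
congr osup; apply/seteqP; split=> [c [d [db ->]]|c [d db <-]]; first by exists d.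
by exists d, db.
Qed.

Definition omega : Ord :=
  oleast [set a | 0 < a /\ forall b, b < a -> osucc b < a].

Lemma omegaE b : b < omega <-> exists n : nat, b = iter n osucc 0.
Proof.
have [s sP] := Ord_strict_sup (fun n : nat => iter n osucc 0).
have [|[w0 wS] wmin] := @oleastP [set a | 0 < a /\ forall b, b < a -> osucc b < a].
  exists s; split; first by apply/sP; exists 0%N.
  move=> c /sP[n cn]; apply/sP; exists n.+1.
  by apply/osucc_le; apply: le_lt_trans cn _; apply: ltOrdS.
split=> [bw|[n ->]]; last by elim: n => //= n; apply: wS.
apply: contrapT => /forallNP nb.
have ltb n : iter n osucc 0 < b.
  elim: n => [|n IH] /=; rewrite lt_neqAle; apply/andP; split.
  - by apply/eqP => b0; apply: (nb 0%N).
  - exact: ole0.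
  - by apply/eqP => bn; apply: (nb n.+1).
  - exact/osucc_le.
have : omega <= s.
  apply: wmin; split; first by apply/sP; exists 0%N.
  move=> c /sP[n cn]; apply/sP; exists n.+1.
  by apply/osucc_le; apply: le_lt_trans cn _; apply: ltOrdS.
move=> /(lt_le_trans bw) /sP[n]; rewrite leNgt; apply/negP/negPn; exact: ltb.
Qed.

Definition omega1 : Ord := oleast [set a | ~ countable (below a)].

Lemma omega1P : ~ countable (below omega1) /\
  forall a, a < omega1 -> countable (below a).
Proof.
have [|nc cmin] := @oleastP [set a | ~ countable (below a)].
  have [a na] := Ord_not_injective nat; exists a => /= /countable_injP [f finj].
  apply: na; exists f => x y xa ya; apply: finj; exact/mem_set.
split=> // a al; apply: contrapT => /cmin; by rewrite leNgt al.
Qed.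

Definition is_cardinal (k : Ord) : Prop :=
  forall a, a < k -> ~ (below a #= below k).

Definition cf (a : Ord) : Ord :=
  oleast [set m | exists f : Ord -> Ord,
    (forall d, d < m -> f d < a) /\
    (forall b, b < a -> exists2 d, d < m & b <= f d)].

Lemma cfP a : exists f : Ord -> Ord,
  (forall d, d < cf a -> f d < a) /\
  (forall b, b < a -> exists2 d, d < cf a & b <= f d).
Proof.
have [] // := @oleastP [set m | exists f : Ord -> Ord,
  (forall d, d < m -> f d < a) /\
  (forall b, b < a -> exists2 d, d < m & b <= f d)].
by exists a, id; split=> // b ba; exists b.
Qed.

Definition infinite_regular_cardinal (k : Ord) : Prop :=
  [/\ is_cardinal k, omega <= k & cf k = k].

(** [[beta, alpha]]-compactness; only the values of [O] below [alpha] matter. *)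
Definition ocompact (X : Type) (tau : set (set X)) (beta alpha : Ord) : Prop :=
  forall O : Ord -> set X,
    (forall d, d < alpha -> tau (O d)) ->
    \bigcup_(d in below alpha) O d = [set: X] ->
  exists H : set Ord,
    [/\ H `<=` below alpha,
        exists2 g, g < beta & has_order_type H g &
        \bigcup_(d in H) O d = [set: X]].

Definition ocompact_infty (X : Type) (tau : set (set X)) (beta : Ord) : Prop :=
  forall alpha, beta <= alpha -> ocompact tau beta alpha.

Definition lindelof_ordinal (X : Type) (tau : set (set X)) : Ord :=
  oleast [set a | 0 < a /\ ocompact_infty tau a].

Lemma lindelof_ordinalP (X : Type) (tau : set (set X)) :
  [/\ 0 < lindelof_ordinal tau,
      ocompact_infty tau (lindelof_ordinal tau) &
      forall b, 0 < b -> ocompact_infty tau b -> lindelof_ordinal tau <= b].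
Proof.
suff [a aP] : exists a, 0 < a /\ ocompact_infty tau a.
  have [|[l0 lc] lmin] := @oleastP [set a | 0 < a /\ ocompact_infty tau a].
    by exists a.
  by split=> // b b0 bc; apply: lmin.
have [a na] := Ord_not_injective X.
exists (osucc a); split=> [|alpha _ O _ Ocov]; first by apply/osuccP/ole0.
have dP x : exists d, d < alpha /\ O d x.
  have : [set: X] x by [].
  by rewrite -Ocov => -[d da Odx]; exists d.
have [d {}dP] := choice dP.
have [g [h [hlt gE Hg]]] := range_order_type d.
exists (range d); split.
- by move=> _ [x _ <-]; case: (dP x).
- exists g => //; rewrite ltNge; apply/negP => /osucc_le ag; apply: na.
  have hinv b : b < g -> exists x, h x = b.
    by move=> bg; have [x _ <-] : range h b by [rewrite -gE]; exists x.
  have [x0 _] := hinv a ag.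
  have hinv' b : exists x, b < a -> h x = b.
    have [/lt_trans/(_ ag)/hinv[x xb]|] := pselect (b < a); last by exists x0.
    by exists x.
  have [f fP] := choice hinv'; exists f => x y /fP fx /fP fy e.
  by rewrite -fx -fy e.
- by apply/seteqP; split=> // x _; exists (d x); [exists x | case: (dP x)].
Qed.

(* Main.v *)
Require Import Defs.
From mathcomp Require Import all_boot all_order.
From mathcomp Require Import boolp classical_sets functions cardinality.
Import Order.TTheory.
Local Open Scope classical_set_scope.
Local Open Scope card_scope.
Local Open Scope order_scope.
Local Open Scope ord_scope.

(** A cover [O] indexed by an ordinal is turned into a rearrangement of itself
    in which small subcovers are impossible.

    For a point [x], the indices [d] with [x] in [O d] form a set that every
    subcover has to meet.  Call points scattered when these sets are pairwise
    disjoint.  If [X] has [kappa] scattered points and [b] is an ordinal of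
    cardinality at most [kappa], then [b] many of the disjoint index sets can be
    laid one after the other, in order type [b]; a subcover meets each of them,
    so its order type is at least [b], and compactness from [b] on fails
    ([not_ocompact_of_scattered]).  Hence the Lindelof ordinal does not embed in
    [kappa] as soon as some cover has [kappa] scattered points.

    Scattered points come from covers that are long in an irredundant way
    ([scattered_points]).  Let [O] be indexed by [M + c], let [|X| <= kappa], and
    suppose that no subcover has type below [M], that the cofinality of [M] is at
    least [kappa] and that [a + kappa + c < M] for [a < M].  An increasing
    sequence [P] of length [kappa] in [M] meets the index sets of all points
    whose index set is unbounded in [M].  For [B < M], the indices up to [B],
    those in [P] and those from [M] on have together a type below [M], so they
    leave a point uncovered; its index set lies between [B] and some bound
    [B' < M].  Iterating [kappa] times yields the scattered points; the
    cofinality of [M] lets the construction pass limits.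

    If compactness from [b] on fails, a subcover of least type of a
    counterexample gives a cover indexed by some [a >= b] without any subcover of
    type below [a] ([least_subcover]), and then [a] embeds in [X].

    Suppose that the Lindelof ordinal is [M + gamma] with
    [M = alpha1 + kappa ^ epsilon].  For [b = M] this gives a cover indexed by
    [M + c] with [c < gamma < kappa * omega], and the hypotheses on [epsilon] are
    what makes [M] closed under [+ kappa] and of cofinality at least [kappa].
    As [M] embeds in [kappa], so does [M + gamma] by [embeds_oadd_lt], a
    contradiction.

    Suppose that [X] is countable and the Lindelof ordinal is neither [omega1]
    nor at most [omega * omega].  It is then countable, and [b = omega * omega]
    gives a cover indexed by [a = m + c] with [c < omega * omega] and [m] least.
    All nonzero final segments of [m] have type at least [omega * omega], so
    [x + omega + c < m] for [x < m], and the same contradiction arises. *)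

Set Implicit Arguments.
Unset Strict Implicit.
Unset Printing Implicit Defensive.

(** * Ordinal arithmetic *)

Lemma ord_ind (P : Ord -> Prop) :
  (forall a, (forall b, b < a -> P b) -> P a) -> forall a, P a.
Proof. by move=> IH a; elim/(well_founded_ind lt_Ord_wf): a. Qed.

Lemma ord_ext (a b : Ord) : (forall x, x < a <-> x < b) -> a = b.
Proof.
move=> ab; apply/eqP; rewrite eq_le; apply/andP.
by split; rewrite leNgt; apply/negP => /ab; rewrite ltxx.
Qed.

Lemma lt_ole (a b : Ord) : (forall x, x < a -> x < b) -> a <= b.
Proof. by move=> h; rewrite leNgt; apply/negP => /h; rewrite ltxx. Qed.

Lemma lt_limit (a b : Ord) : ~ is_succ b -> a < b -> osucc a < b.
Proof.
move=> nb /osucc_le; rewrite le_eqVlt => /orP[/eqP e|//].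
by case: nb; exists a.
Qed.

Lemma nlt0 (a : Ord) : ~ a < 0.
Proof. by move=> h; have := lt_le_trans h (ole0 a); rewrite ltxx. Qed.

Lemma gt0 (a : Ord) : 0 < a <-> a <> 0.
Proof.
split=> [h e|n]; first by move: h; rewrite e ltxx.
by rewrite lt_neqAle ole0 andbT eq_sym; apply/eqP.
Qed.

Lemma osup_ltP (f : Ord -> Ord) b x :
  x < osup (f @` below b) <-> exists2 d, d < b & x < f d.
Proof.
have [ub lub] := osupP (image_below_bounded b f).
split=> [xs|[d db xf]]; last by apply: lt_le_trans xf (ub _ _); exists d.
apply: contrapT => n; move: xs; rewrite ltNge => /negP; apply; apply: lub.
by move=> _ [d db <-]; rewrite leNgt; apply/negP => h; apply: n; exists d.
Qed.

Variant ord_case (b : Ord) : Prop :=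
  | OrdZero of b = 0
  | OrdSucc c of b = osucc c
  | OrdLim of b <> 0 & ~ is_succ b.

Lemma ordP b : ord_case b.
Proof.
have [->|n0] := pselect (b = 0); first exact: OrdZero.
by have [[c ->]|ns] := pselect (is_succ b); [exact: OrdSucc erefl|exact: OrdLim].
Qed.

Lemma oadd0 (a : Ord) : a + 0 = a. Proof. exact: orec0. Qed.
Lemma oaddS (a b : Ord) : a + osucc b = osucc (a + b). Proof. exact: orecS. Qed.

(** The order-theoretic meaning of the sum, [a] followed by a copy of [b], from
    which the laws of addition follow by comparing initial segments. *)
Lemma oaddP (a b x : Ord) : x < a + b <-> x < a \/ exists2 c, c < b & x = a + c.
Proof.
elim/ord_ind: b x => b IH x; case: (ordP b) => [->|c bE|b0 nb].
- by rewrite oadd0; split=> [|[//|[c /nlt0]]]; [left|].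
- have cb : c < b by rewrite bE; apply: ltOrdS.
  rewrite bE oaddS osuccP; split.
    rewrite le_eqVlt => /orP[/eqP ->|/(IH _ cb)[?|[d dc ->]]]; [|by left|].
      by right; exists c => //; apply: ltOrdS.
    by right; exists d => //; apply: lt_trans dc (ltOrdS c).
  move=> [xa|[d /osuccP]]; first by apply/ltW/IH => //; left.
  rewrite le_eqVlt => /orP[/eqP -> -> //|dc ->].
  by apply/ltW/IH => //; right; exists d.
- rewrite [a + b](orec_lim _ _ b0 nb) osup_ltP; split.
    move=> [d db /(IH _ db)[xa|[c cd ->]]]; [by left|right].
    by exists c => //; apply: lt_trans db.
  move=> [xa|[c cb ->]]; first by exists 0; [exact/gt0|rewrite -/(a + 0) oadd0].
  exists (osucc c); first exact: lt_limit.
  by rewrite -/(a + _) oaddS ltOrdS.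
Qed.

Lemma oadd_ltr (a b c : Ord) : b < c -> a + b < a + c.
Proof. by move=> bc; apply/oaddP; right; exists b. Qed.

Lemma oadd_ler (a b c : Ord) : b <= c -> a + b <= a + c.
Proof. by rewrite le_eqVlt => /orP[/eqP ->//|/oadd_ltr/ltW]. Qed.

Lemma oadd_ltrE (a b c : Ord) : (a + b < a + c) = (b < c).
Proof.
by apply/idP/idP=> [|/oadd_ltr//]; apply: contraTT; rewrite -!leNgt => /oadd_ler.
Qed.

Lemma oadd_inj (a b c : Ord) : a + b = a + c -> b = c.
Proof. by move=> e; apply: ord_ext => x; rewrite -!(oadd_ltrE a x) e. Qed.

Lemma oaddl_le (a b : Ord) : a <= a + b.
Proof. by rewrite -{1}[a]oadd0; apply/oadd_ler/ole0. Qed.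

Lemma osub (a b : Ord) : a <= b -> exists c, b = a + c.
Proof.
move=> ab; have : b < a + osucc b.
  apply: lt_le_trans (ltOrdS b) _.
  apply: (ord_ind (P := fun b => b <= a + b)) => {ab b} b IH.
  by apply: lt_ole => x xb; apply: le_lt_trans (IH _ xb) (oadd_ltr _ xb).
by case/oaddP => [ba|[c _ ->]]; [move: ab; rewrite leNgt ba | exists c].
Qed.

Lemma oaddA (a b c : Ord) : a + (b + c) = a + b + c.
Proof.
elim/ord_ind: c => c IH; apply: ord_ext => x; split.
  case/oaddP => [xa|[d /oaddP[db|[e ec ->]] ->]]; apply/oaddP; last 1 first.
  - by right; exists e => //; apply: IH.
  - by left; apply: lt_le_trans xa (oaddl_le _ _).
  - by left; apply: oadd_ltr.
case/oaddP => [/oaddP[xa|[d db ->]]|[e ec ->]]; last first.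
- by rewrite -IH //; do 2 apply: oadd_ltr.
- by apply/oadd_ltr; apply: lt_le_trans db (oaddl_le _ _).
- by apply: lt_le_trans xa (oaddl_le _ _).
Qed.

Lemma oadd_lel (a b c : Ord) : a <= b -> a + c <= b + c.
Proof.
move=> ab; elim/ord_ind: c => c IH; apply: lt_ole => x /oaddP[xa|[d dc ->]].
  by apply: lt_le_trans xa (le_trans ab (oaddl_le _ _)).
by apply: le_lt_trans (IH _ dc) (oadd_ltr _ dc).
Qed.

Lemma omul0 (a : Ord) : a * 0 = 0. Proof. exact: orec0. Qed.
Lemma omulS (a b : Ord) : a * osucc b = a * b + a. Proof. exact: orecS. Qed.

(** [a * b] is cut into [b] consecutive copies of [a], the [i]-th one ending at
    [a * i + a]. *)
Lemma omulP (a b x : Ord) : x < a * b <-> exists2 i, i < b & x < a * i + a.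
Proof.
elim/ord_ind: b x => b IH x; case: (ordP b) => [->|c bE|b0 nb].
- by rewrite omul0; split=> [/nlt0|[i /nlt0]].
- have cb : c < b by rewrite bE; apply: ltOrdS.
  rewrite bE omulS; split=> [h|[i /osuccP]]; first by exists c => //; apply: ltOrdS.
  rewrite le_eqVlt => /orP[/eqP -> //|ic xi].
  by apply: lt_le_trans (oaddl_le _ _); apply/IH => //; exists i.
- rewrite [a * b](orec_lim _ _ b0 nb) osup_ltP; split.
    by move=> [d db /(IH _ db)[i id xi]]; exists i => //; apply: lt_trans db.
  move=> [i ib xi]; exists (osucc i); first exact: lt_limit.
  by rewrite -/(a * _) omulS.
Qed.

Lemma omul_ler (a b c : Ord) : b <= c -> a * b <= a * c.
Proof.
move=> bc; apply: lt_ole => x /omulP[i ib xi]; apply/omulP; exists i => //.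
exact: lt_le_trans bc.
Qed.

Lemma omul1l b : 1 * b = b.
Proof.
elim/ord_ind: b => b IH; apply: ord_ext => x; rewrite omulP; split.
  by move=> [i ib]; rewrite oaddS oadd0 IH // osuccP => xi; apply: le_lt_trans ib.
by move=> xb; exists x => //; rewrite oaddS oadd0 IH // ltOrdS.
Qed.

Lemma omul_ltr (a b c : Ord) : 0 < a -> b < c -> a * b < a * c.
Proof.
by move=> a0 bc; apply/omulP; exists b => //; rewrite -{1}[a * b]oadd0 oadd_ltr.
Qed.

Lemma oexp0 (a : Ord) : a ^ 0 = 1. Proof. exact: orec0. Qed.
Lemma oexpS (a b : Ord) : a ^ osucc b = a ^ b * a. Proof. exact: orecS. Qed.
Lemma oexp_lim (a b x : Ord) : b <> 0 -> ~ is_succ b ->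
  x < a ^ b <-> exists2 d, d < b & x < a ^ d.
Proof. by move=> b0 nb; rewrite [a ^ b](orec_lim _ _ b0 nb) osup_ltP. Qed.

Lemma oexp1 (a : Ord) : a ^ 1 = a. Proof. by rewrite oexpS oexp0 omul1l. Qed.

Lemma oadd0l (a : Ord) : 0 + a = a.
Proof.
elim/ord_ind: a => a IH; apply: ord_ext => x.
rewrite oaddP; split=> [[/nlt0//|[c ca ->]]|xa]; first by rewrite IH.
by right; exists x => //; rewrite IH.
Qed.

Lemma omulr1 (a : Ord) : a * 1 = a.
Proof. by rewrite omulS omul0 oadd0l. Qed.

Lemma omull_le (a b : Ord) : 0 < b -> a <= a * b.
Proof. by move=> b0; rewrite -{1}[a]omulr1; apply/omul_ler/osucc_le. Qed.

Lemma oexp_le (a b c : Ord) : 0 < a -> b <= c -> a ^ b <= a ^ c.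
Proof.
move=> a0; elim/ord_ind: c b => c IH b; rewrite le_eqVlt => /orP[/eqP ->//|].
case: (ordP c) => [->|d cE|c0 nc]; first by move/nlt0.
  have dc : d < c by rewrite cE; apply: ltOrdS.
  rewrite cE oexpS => /osuccP bd.
  by apply: le_trans (IH _ dc _ bd) (omull_le _ a0).
by move=> bc; apply: lt_ole => x xb; apply/oexp_lim => //; exists b.
Qed.

Lemma oexp_gt0 (a b : Ord) : 0 < a -> 0 < a ^ b.
Proof.
by move=> a0; apply: lt_le_trans (oexp_le a0 (ole0 b)); rewrite oexp0 ltOrdS.
Qed.

Lemma oexp_lt (a b c : Ord) : 1 < a -> b < c -> a ^ b < a ^ c.
Proof.
move=> a1 /osucc_le bc; have a0 : 0 < a by apply: le_lt_trans (ole0 1) a1.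
apply: lt_le_trans (oexp_le a0 bc); rewrite oexpS.
have /(omul_ltr (oexp_gt0 b a0)) := a1; apply: le_lt_trans.
by apply: omull_le; apply: ltOrdS.
Qed.

(** * Cofinality and closure under addition *)

(** For limit [M] this says [k <= cf M].  The weak inequality [f d <= B] makes it
    hold for successor [M] too, so that for [k = omega] it asks nothing beyond
    [0 < M]. *)
Definition cof_ge (k M : Ord) : Prop := forall n f, n < k ->
  (forall d, d < n -> f d < M) -> exists2 B, B < M & forall d, d < n -> f d <= B.

Lemma cf_le (a n : Ord) (f : Ord -> Ord) : (forall d, d < n -> f d < a) ->
  (forall b, b < a -> exists2 d, d < n & b <= f d) -> cf a <= n.
Proof.
move=> fa af.
have [|_ cfmin] := @oleastP [set m | exists f : Ord -> Ord,
  (forall d, d < m -> f d < a) /\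
  (forall b, b < a -> exists2 d, d < m & b <= f d)].
  by exists a, id; split=> // b ba; exists b.
by apply: cfmin; exists f.
Qed.

Lemma cof_ge_cf (a : Ord) : cof_ge (cf a) a.
Proof.
move=> n f nk fa; apply: contrapT => nB.
suff : cf a <= n by rewrite leNgt nk.
apply: (cf_le fa) => b ba; apply: contrapT => nd; apply: nB.
exists b => // d dn; rewrite leNgt; apply/negP => /ltW bf; apply: nd.
by exists d.
Qed.

(** A nondecreasing cofinal map from [e] to [M] transports bounds. *)
Lemma cof_ge_sup (k e M : Ord) (g : Ord -> Ord) : cof_ge k e ->
  (forall i j, i <= j -> g i <= g j) -> (forall i, i < e -> g i < M) ->
  (forall x, x < M -> exists2 i, i < e & x <= g i) -> cof_ge k M.
Proof.
move=> cke gmono gM Mg n f nk fM.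
have /choice[i iP] d : exists i, d < n -> i < e /\ f d <= g i.
  have [/fM/Mg[i ie fi]|] := pselect (d < n); first by exists i.
  by exists 0.
have [|I Ie iI] := cke n i nk; first by move=> d /iP[].
exists (g I) => [|d dn]; first exact: gM.
by have [_ /le_trans] := iP _ dn; apply; apply/gmono/iI.
Qed.

Lemma cof_ge_oadd (k a b : Ord) : 0 < b -> cof_ge k b -> cof_ge k (a + b).
Proof.
move=> b0 cb; apply: (cof_ge_sup (g := oadd a) cb).
- by move=> i j; apply: oadd_ler.
- by move=> i; apply: oadd_ltr.
- move=> x /oaddP[xa|[c cb' ->]]; last by exists c.
  by exists 0 => //; rewrite oadd0 ltW.
Qed.

Lemma cof_ge_omega (M : Ord) : 0 < M -> cof_ge omega M.
Proof.
move=> M0 _ f /omegaE[n ->]; elim: n => [|n IH] fM.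
  by exists 0 => // d /nlt0.
have [|B BM fB] := IH.
  by move=> d dn; apply: fM; apply: lt_trans dn _; apply: ltOrdS.
have fn := fM _ (ltOrdS _).
have [le|/ltW le] := leP B (f (iter n osucc 0)).
  exists (f (iter n osucc 0)) => // d /osuccP.
  by rewrite le_eqVlt => /orP[/eqP ->//|/fB h]; apply: le_trans le.
by exists B => // d /osuccP; rewrite le_eqVlt => /orP[/eqP ->//|/fB].
Qed.

Definition closed_add (k M : Ord) : Prop := forall a, a < M -> a + k < M.

Lemma closed_add_oadd (k a b : Ord) : 0 < b ->
  closed_add k b -> closed_add k (a + b).
Proof.
move=> b0 cb; have h c : c < b -> a + c + k < a + b.
  by move=> cb'; rewrite -oaddA oadd_ltr // cb.
move=> x /oaddP[xa|[c cb' ->]]; last exact: h.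
by apply: (le_lt_trans (oadd_lel k (ltW xa))); rewrite -{1}[a]oadd0 h.
Qed.

Lemma lt_omul_omega (k c : Ord) : c < k * omega ->
  exists n, c < k * iter n osucc 0.
Proof.
move=> /omulP[_ /omegaE[n ->] cn]; exists n.+1; by rewrite /= omulS.
Qed.

Lemma closed_add_lt (k M a c : Ord) : closed_add k M -> a < M ->
  c < k * omega -> a + c < M.
Proof.
move=> kM aM /lt_omul_omega[n /ltW/oadd_ler/le_lt_trans]; apply.
elim: n => [|n IH] /=; first by rewrite omul0 oadd0.
by rewrite omulS oaddA kM.
Qed.

Lemma closed_add_omul (k a : Ord) : 0 < k -> ~ is_succ k -> k <= a ->
  closed_add k (a * k).
Proof.
move=> k0 nk ka x /omulP[i ik xi]; have ik' := lt_limit nk ik.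
apply: (le_lt_trans (oadd_lel k (ltW xi))).
rewrite -omulS; apply: le_lt_trans (oadd_ler _ ka) _; rewrite -omulS.
by apply: omul_ltr; [apply: lt_le_trans ka|apply: lt_limit].
Qed.

Lemma omega_gt (n : nat) : iter n osucc 0 < omega.
Proof. by apply/omegaE; exists n. Qed.

Lemma omega_limit : ~ is_succ omega.
Proof.
move=> [b bE]; have /omegaE[n bn] : b < omega by rewrite bE ltOrdS.
by have := omega_gt n.+1; rewrite bE bn ltxx.
Qed.

Section Regular.
Variable k : Ord.
Hypothesis reg : infinite_regular_cardinal k.

Let wk : omega <= k. Proof. by case: reg. Qed.

Lemma regular_gt1 : 1 < k.
Proof. exact: lt_le_trans (omega_gt 1) wk. Qed.

Let k0 : 0 < k. Proof. exact: lt_trans (ltOrdS 0) regular_gt1. Qed.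

Lemma regular_limit : ~ is_succ k.
Proof.
have [_ _ cfk] := reg; move=> [b kE].
have := regular_gt1; rewrite ltNge => /negP; apply; rewrite -{1}cfk.
apply: (cf_le (f := fun=> b)) => [d _|c]; first by rewrite kE ltOrdS.
by rewrite kE => /osuccP cb; exists 0 => //; apply: ltOrdS.
Qed.

(** At a successor [s + 1] with [s > 0], the power [k ^ s * k] is a limit of
    multiples of [k ^ s >= k]; at a limit, cofinally many smaller exponents are
    such successors. *)
Lemma closed_add_oexp (e : Ord) : 1 < e -> closed_add k (k ^ e).
Proof.
have S (s : Ord) : 0 < s -> closed_add k (k ^ osucc s).
  move=> s0; rewrite oexpS; apply: closed_add_omul k0 regular_limit _.
  by rewrite -{1}[k]oexp1; apply: oexp_le => //; apply/osucc_le.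
move=> e1; case: (ordP e) => [e0|s eE|e0 ne].
- by move: e1; rewrite e0 => /nlt0.
- by rewrite eE; apply: S; move: e1; rewrite eE => /osuccP/osucc_le.
move=> x /oexp_lim[//|//|s se xs].
have s1e : osucc (osucc s) < e by apply: lt_limit => //; apply: lt_limit.
apply: lt_le_trans (oexp_le k0 (ltW s1e)).
apply: S; first exact: le_lt_trans (ole0 s) (ltOrdS s).
apply: lt_le_trans xs (oexp_le k0 _); apply/ltW.
exact: lt_trans (ltOrdS _) (ltOrdS _).
Qed.

(** The two cases on [e] give the cofinal maps [i |-> k ^ s * (i + 1)] from [k]
    and [i |-> k ^ i] from [e]. *)
Lemma cof_ge_oexp (e : Ord) : 1 < e -> is_succ e \/ cf e = k ->
  cof_ge k (k ^ e).
Proof.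
have [_ _ cfk] := reg; have ckk : cof_ge k k by rewrite -{1}cfk; apply: cof_ge_cf.
move=> e1 H; case: (ordP e) => [e0|s eE|e0 ne].
- by move: e1; rewrite e0 => /nlt0.
- rewrite eE oexpS; apply: (cof_ge_sup (g := fun i => k ^ s * osucc i) ckk).
  + move=> i j ij; apply: omul_ler; apply/osucc_le; exact: le_lt_trans (ltOrdS _).
  + move=> i ik; apply: omul_ltr; first exact: oexp_gt0.
    exact: lt_limit regular_limit _.
  + by move=> x /omulP[i ik xi]; exists i => //; rewrite omulS ltW.
- have {}H : cf e = k by case: H.
  apply: (cof_ge_sup (e := e) (g := fun i => k ^ i)).
  + by rewrite -H; apply: cof_ge_cf.
  + by move=> i j ij; apply: oexp_le.
  + by move=> i ie; apply: oexp_lt => //; apply: regular_gt1.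
  + by move=> x /oexp_lim[//|//|i ie xi]; exists i => //; apply: ltW.
Qed.

End Regular.

(** * Embeddings of ordinals as sets *)

Lemma ord_decomp (a : Ord) : exists l n, ~ is_succ l /\ a = iter n osucc l.
Proof.
elim/ord_ind: a => a IH; have [[b aE]|na] := pselect (is_succ a); last first.
  by exists a, 0%N.
have [|l [n [nl bE]]] := IH b; first by rewrite aE ltOrdS.
by exists l, n.+1; rewrite /= -bE.
Qed.

Lemma iter_osucc_inj (n m : nat) (l l' : Ord) : ~ is_succ l -> ~ is_succ l' ->
  iter n osucc l = iter m osucc l' -> n = m /\ l = l'.
Proof.
move=> nl nl'; elim: n m => [|n IH] [|m] //=.
- by move=> e; case: nl; exists (iter m osucc l').
- by move=> e; case: nl'; exists (iter n osucc l).
- by move/osucc_inj/IH => [-> ->].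
Qed.

Lemma iter_osucc_lt (k a : Ord) n : ~ is_succ k -> a < k -> iter n osucc a < k.
Proof. by move=> nk ak; elim: n => //= n IH; apply: lt_limit. Qed.

(** Two disjoint copies of a limit ordinal embed in it: write an ordinal as
    [l + n] with [l] not a successor and [n] finite, and send the copy number [e]
    of [l + n] to [l + (2 n + e)]. *)
Lemma doubling : exists D : bool -> Ord -> Ord,
  (forall k e a, ~ is_succ k -> a < k -> D e a < k) /\
  (forall e e' a a', D e a = D e' a' -> e = e' /\ a = a').
Proof.
have /choice[dec decP] a : exists p : Ord * nat,
    ~ is_succ p.1 /\ a = iter p.2 osucc p.1.
  by have [l [n h]] := ord_decomp a; exists (l, n).
exists (fun e a => iter (e + (dec a).2.*2)%N osucc (dec a).1); split.
  move=> k e a nk ak; apply: iter_osucc_lt => //; apply: le_lt_trans ak.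
  have [_ {2}->] := decP a; elim: (dec a).2 => //= n /le_trans; apply.
  exact/ltW/ltOrdS.
move=> e e' a a' /iter_osucc_inj[]; [by case: (decP a)|by case: (decP a')|].
move=> E l; have ee' : e = e'.
  by move/(congr1 odd): E; rewrite !oddD !odd_double !addbF !oddb.
split=> //; have [_ ->] := decP a; have [_ ->] := decP a'; rewrite -l.
by congr iter; move/eqP: E; rewrite ee' eqn_add2l => /eqP/double_inj.
Qed.

Definition embeds (a b : Ord) : Prop := exists j : Ord -> Ord,
  (forall x, x < a -> j x < b) /\
  (forall x y, x < a -> y < a -> j x = j y -> x = y).

Lemma embeds_le (a a' b : Ord) : a' <= a -> embeds a b -> embeds a' b.
Proof.
move=> le [j [jb ji]]; exists j; split=> [x xa|x y xa ya].
  exact/jb/(lt_le_trans xa).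
by apply: ji; [apply: lt_le_trans xa le|apply: lt_le_trans ya le].
Qed.

Lemma embeds_oadd (a k : Ord) : ~ is_succ k -> embeds a k -> embeds (a + k) k.
Proof.
move=> nk [j [jk ji]]; have [D [Dk Di]] := doubling.
have /choice[c cP] x : exists c, x < a + k -> x < a \/ c < k /\ x = a + c.
  by have [/oaddP[|[c]]|] := pselect (x < a + k); [exists 0; left|exists c; right|
    exists 0].
exists (fun x => if x < a then D true (j x) else D false (c x)); split.
  by move=> x /cP; case: ifPn => [xa _|_ [//|[ck _]]]; apply: Dk => //; apply: jk.
move=> x y /cP xP /cP yP; move: xP yP.
case: ifPn => [xa _|_]; case: ifPn => [ya _|_].
- by move=> /Di[_ jxy]; apply: ji.
- by move=> _ /Di[].
- by move=> _ /Di[].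
- by move=> [//|[_ xE]] [//|[_ yE]] /Di[_ cc]; rewrite xE yE cc.
Qed.

Lemma embeds_oadd_lt (a c k : Ord) : ~ is_succ k -> embeds a k ->
  c < k * omega -> embeds (a + c) k.
Proof.
move=> nk ak /lt_omul_omega[n /ltW/(oadd_ler a)/embeds_le]; apply.
elim: n => [|n IH] /=; first by rewrite omul0 oadd0.
by rewrite omulS oaddA; apply: embeds_oadd.
Qed.

(** * Order types of sets of ordinals *)

Definition covers (X I : Type) (O : I -> set X) (H : set I) : Prop :=
  forall x, exists2 i, H i & O i x.

Lemma coversP (X I : Type) (O : I -> set X) H :
  \bigcup_(i in H) O i = [set: X] <-> covers O H.
Proof.
split=> [e x|c]; first by have : [set: X] x by []; rewrite -e => -[i]; exists i.
by apply/seteqP; split=> // x _; have [i] := c x; exists i.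
Qed.

Lemma increasing_ge (g : Ord) (f : Ord -> Ord) :
  (forall x y, x < y -> y < g -> f x < f y) -> forall b, b < g -> b <= f b.
Proof.
move=> inc; elim/ord_ind=> b IH bg; rewrite leNgt; apply/negP => fb.
have := inc _ _ fb bg; rewrite ltNge => /negP; apply.
by apply: IH => //; apply: lt_trans bg.
Qed.

Lemma increasing_le (a b : Ord) (f : Ord -> Ord) :
  (forall x y, x < y -> y < a -> f x < f y) -> (forall x, x < a -> f x < b) ->
  a <= b.
Proof.
move=> inc fb; rewrite leNgt; apply/negP => ba.
by have := fb _ ba; rewrite ltNge (increasing_ge inc ba).
Qed.

Lemma order_type_ge (H : set Ord) (g a : Ord) (e : Ord -> Ord) :
  has_order_type H g -> (forall i j, i < j -> j < a -> e i < e j) ->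
  (forall i, i < a -> H (e i)) -> a <= g.
Proof.
move=> [f [finc fH]] einc eH.
have /choice[r rP] i : exists r, i < a -> r < g /\ f r = e i.
  have [/eH|] := pselect (i < a); last by exists 0.
  by rewrite -fH => -[r rg fr]; exists r.
apply: (increasing_le (f := r)) => [i j ij ja|i /rP[]//].
have ia := lt_trans ij ja.
have [rig fri] := rP _ ia; have [rjg frj] := rP _ ja.
rewrite ltNge; apply/negP => le; have := einc _ _ ij ja.
rewrite -fri -frj ltNge => /negP; apply.
by move: le; rewrite le_eqVlt => /orP[/eqP ->//|/finc h]; apply/ltW/h.
Qed.

Lemma order_type_le (H : set Ord) (a b : Ord) (f : Ord -> Ord) :
  H `<=` below a -> (forall x y, H x -> H y -> x < y -> f x < f y) ->
  (forall x, H x -> f x < b) -> exists2 g, g <= b & has_order_type H g.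
Proof.
move=> Ha finc fb; have [A [u uE]] := below_small a.
pose d (t : {t : A | H (u t)}) := u (proj1_sig t).
have dH : range d = H.
  apply/seteqP; split=> [_ [[t Ht] _ <-]//|x Hx].
  have : below a x by apply: Ha.
  rewrite uE => -[t _ utx]; rewrite -utx in Hx *.
  by exists (exist _ t Hx).
have [g [_ [_ _]]] := range_order_type d; rewrite dH => gH; exists g => //.
have [s [sinc sH]] := gH.
have Hs x : x < g -> H (s x) by move=> xg; rewrite -sH; exists x.
apply: (increasing_le (f := f \o s)) => [x y xy yg|x /Hs/fb//] /=.
by apply: finc; [apply/Hs/(lt_trans xy)|apply: Hs|apply: sinc].
Qed.

Lemma order_type_comp (f : Ord -> Ord) (a g : Ord) (H : set Ord) :
  (forall x y, x < y -> y < a -> f x < f y) -> H `<=` below a ->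
  has_order_type H g -> has_order_type (f @` H) g.
Proof.
move=> finc Ha [s [sinc sH]]; exists (f \o s); split; last first.
  by rewrite -sH image_comp.
move=> x y xy yg /=; apply: finc; first exact: sinc.
by apply: Ha; rewrite -sH; exists y.
Qed.

Lemma has_order_type_below (a : Ord) : has_order_type (below a) a.
Proof. by exists id; split=> //; rewrite image_id. Qed.

(** * Rearranging and shortening covers *)

Section Compact.
Variables (X : Type) (tau : set (set X)).

(** Compactness for families ordered by a key [d] in the ordinals.  The index
    type [A] is arbitrary because [below a] lives in too large a universe for
    [range_order_type], which has to be fed with the small types of
    [below_small]; these may list an ordinal twice, so that [d] can only be asked to
    separate different sets. *)
Lemma compact_family (A : Type) (F : A -> set X) (d : A -> Ord) (b : Ord) :
  0 < b -> ocompact_infty tau b ->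
  (forall t u, d t = d u -> F t = F u) -> (forall t, tau (F t)) ->
  covers F setT -> exists (S : set A) (g : Ord),
    [/\ g < b, has_order_type (d @` S) g & covers F S].
Proof.
move=> b0 cb dinj tauF Fcov.
have [g [h [hlt gE dg]]] := range_order_type d.
have [gb|bg] := ltP g b; first by exists setT, g.
have hs i : i < g -> exists t, h t = i.
  by move=> ig; have [t _ <-] : range h i by [rewrite -gE]; exists t.
have [t0 _] := hs _ (lt_le_trans b0 bg).
have /choice[r rP] i : exists t, i < g -> h t = i.
  by have [/hs[t ti]|] := pselect (i < g); [exists t|exists t0].
have hg t : h t < g by have : range h (h t) by [exists t]; rewrite -gE.
have rh t : F (r (h t)) = F t.
  have e := rP _ (hg t); apply: dinj; apply/eqP.
  by rewrite eq_le !leNgt -!hlt e ltxx.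
have [i _||H [Hg [g' g'b Hg'] /coversP Hcov]] := cb g bg (F \o r).
- exact: tauF.
- by apply/coversP => x; have [t _ Ftx] := Fcov x; exists (h t); rewrite /= ?rh.
exists (r @` H), g'; split=> //; last first.
  by move=> x; have [i Hi Fx] := Hcov x; exists (r i) => //; exists i.
rewrite image_comp; apply: (order_type_comp (a := g)) => // i j ij jg /=.
by rewrite -hlt !rP // (lt_trans ij).
Qed.

(** Among the subcovers of a cover without subcover of type below [b], reindex
    one of least type. *)
Lemma least_subcover (b : Ord) : ~ ocompact_infty tau b -> exists a O,
  [/\ b <= a, forall d, d < a -> tau (O d), covers O (below a) &
   forall H g, H `<=` below a -> g < a -> has_order_type H g -> ~ covers O H].
Proof.
move=> /existsNP[a /not_implyP[ba /existsNP[O]]].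
move=> /not_implyP[tauO /not_implyP[/coversP Ocov nsub]].
pose P := [set g | exists H, [/\ H `<=` below a, has_order_type H g & covers O H]].
have [|[H [Ha [f [finc fH]] Hcov]] gmin] := @oleastP P.
  by exists a, (below a); split=> //; apply: has_order_type_below.
set g := oleast P in finc fH gmin.
have fa i : i < g -> f i < a by move=> ig; apply: Ha; rewrite -fH; exists i.
exists g, (O \o f); split.
- rewrite leNgt; apply/negP => gb; apply: nsub; exists H.
  by split=> //; [exists g => //; exists f|apply/coversP].
- by move=> i ig; apply/tauO/fa.
- move=> x; have [d] := Hcov x; rewrite -fH => -[i ig <-] Ox.
  by exists i.
- move=> K g' Kg g'g Kg' Kcov; move: g'g; rewrite ltNge => /negP; apply.
  apply: gmin; exists (f @` K); split.
  + by move=> _ [i /Kg ig <-]; apply: fa.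
  + exact: order_type_comp finc Kg Kg'.
  + by move=> x; have [i Ki Ox] := Kcov x; exists (f i) => //; exists i.
Qed.

(** Choosing for each point an index whose set contains it yields a subcover, so
    the chosen indices have type at least [a]. *)
Lemma least_subcover_inj (a : Ord) (O : Ord -> set X) : covers O (below a) ->
  (forall H g, H `<=` below a -> g < a -> has_order_type H g -> ~ covers O H) ->
  [set: X] !=set0 ->
  exists j : Ord -> X, forall x y, x < a -> y < a -> j x = j y -> x = y.
Proof.
move=> Ocov nsub [x0 _].
have /choice[d dP] x : exists d, d < a /\ O d x by have [d] := Ocov x; exists d.
have [g [h [_ gE dg]]] := range_order_type d.
have ag : a <= g.
  rewrite leNgt; apply/negP => ga; apply: (nsub (range d) g) => //.
  - by move=> _ [x _ <-]; case: (dP x).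
  - by move=> x; exists (d x); [exists x|case: (dP x)].
have /choice[j jP] i : exists x, i < a -> h x = i.
  have [ia|] := pselect (i < a); last by exists x0.
  have [x _ <-] : range h i by rewrite -gE /=; apply: lt_le_trans ag.
  by exists x.
by exists j => x y xa ya e; rewrite -(jP x) // -(jP y) // e.
Qed.

(** An index [d] whose set contains [x (j i)] with [i < b] gets position [i],
    unique by disjointness; all other indices get position [0].  In the
    lexicographic order by position and index, a subcover contains an increasing
    sequence of type [b]. *)
Lemma not_ocompact_of_scattered (k b a : Ord) (O : Ord -> set X) (x : Ord -> X) :
  0 < b -> embeds b k -> (forall d, d < a -> tau (O d)) -> covers O (below a) ->
  (forall i j d, i < k -> j < k -> d < a -> O d (x i) -> O d (x j) -> i = j) ->
  ~ ocompact_infty tau b.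
Proof.
move=> b0 [j [jk jinj]] tauO Ocov xdisj cb.
have /choice[pos posP] d : exists i, i < b /\
    forall i', i' < b -> d < a -> O d (x (j i')) -> i = i'.
  have [[i [ib da Oi]]|n] := pselect (exists i, [/\ i < b, d < a & O d (x (j i))]).
    exists i; split=> // i' i'b _ Oi'; apply: jinj => //.
    by apply: (xdisj _ _ d) => //; apply: jk.
  by exists 0; split=> // i' i'b da Oi'; case: n; exists i'.
have [A [u uE]] := below_small a.
have ua t : u t < a by have : range u (u t) by [exists t]; rewrite -uE.
(* This key realizes the lexicographic order because [d < a]. *)
pose key d := a * pos d + d.
have key_lt d d' : d < a -> pos d < pos d' -> key d < key d'.
  move=> da /osucc_le/(omul_ler a); rewrite omulS => le.
  by apply: lt_le_trans (le_trans le (oaddl_le _ _)); apply: oadd_ltr.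
have key_inj d d' : d < a -> d' < a -> key d = key d' -> d = d'.
  move=> da d'a e; have [] := ltgtP (pos d) (pos d').
  - by move=> /(key_lt _ _ da); rewrite e ltxx.
  - by move=> /(key_lt _ _ d'a); rewrite e ltxx.
  - by move=> pE; move: e; rewrite /key pE => /oadd_inj.
have [|||||S [g [gb Sg Scov]]] := @compact_family A (O \o u) (key \o u) b => //.
- by move=> t t' /= /key_inj ->.
- by move=> t; apply/tauO/ua.
- move=> y; have [d] := Ocov y; rewrite uE => -[t _ <-] Oy.
  by exists t.
move: gb; rewrite ltNge => /negP; apply.
have /choice[e eP] i : exists t, i < b -> S t /\ O (u t) (x (j i)).
  by have [t St Ot] := Scov (x (j i)); exists t.
apply: (order_type_ge (e := key \o u \o e) Sg) => [i i' ii' i'b|i ib] /=; last first.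
  by exists (e i) => //; case: (eP i ib).
have ib := lt_trans ii' i'b.
have [_ Oi] := eP _ ib; have [_ Oi'] := eP _ i'b.
have [_ /(_ i ib (ua _) Oi) pi] := posP (u (e i)).
have [_ /(_ i' i'b (ua _) Oi') pi'] := posP (u (e i')).
by apply: key_lt (ua _) _; rewrite pi pi'.
Qed.
End Compact.

(** * Scattered points *)

(** Dependent choice of length [k], where a choice may depend on the set of the
    previous ones. *)
Lemma transfinite_choice (A : Type) (k : Ord)
    (Q : Ord -> set A -> A -> Prop) (a0 : A) :
  (forall f n, n < k -> (forall m, m < n -> Q m (f @` below m) (f m)) ->
     exists a, Q n (f @` below n) a) ->
  exists f : Ord -> A, forall n, n < k -> Q n (f @` below n) (f n).
Proof.
move=> step.
have /choice[c cP] (p : Ord * set A) :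
    exists a, (exists a, Q p.1 p.2 a) -> Q p.1 p.2 a.
  by have [[a h]|] := pselect (exists a, Q p.1 p.2 a); [exists a|exists a0].
pose F n (G : forall m, m < n -> A) : A :=
  c (n, [set a | exists m (mn : m < n), G m mn = a]).
pose f := Fix lt_Ord_wf (fun=> A) F.
have fE n : f n = c (n, f @` below n).
  rewrite /f Fix_eq; last first.
    move=> {}n G H GH; congr (F n _).
    by apply: functional_extensionality_dep => m; apply: functional_extensionality_dep.
  congr (c (n, _)); apply/seteqP; split=> a [m].
    by move=> [mn <-]; exists m.
  by move=> mn <-; exists m, mn.
exists f; elim/ord_ind=> n IH nk; rewrite fE; apply: (cP (n, f @` below n)) => /=.
by apply: step => // m mn; apply: IH => //; apply: lt_trans nk.
Qed.

Section Scattered.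
Variables (X : Type) (k M c : Ord) (O : Ord -> set X) (e : Ord -> X).
Hypothesis k0 : 0 < k.
Hypothesis e_surj : forall x, exists2 i, i < k & e i = x.
Hypothesis cofM : cof_ge k M.
Hypothesis addM : forall a, a < M -> a + k + c < M.
Hypothesis nsub : forall H g, H `<=` below (M + c) -> g < M ->
  has_order_type H g -> ~ covers O H.

Let addMk a : a < M -> a + k < M.
Proof. by move=> /addM; apply: le_lt_trans; apply: oaddl_le. Qed.

Let addMS a : a < M -> osucc a < M.
Proof.
move=> /addMk; apply: le_lt_trans; rewrite -[a in osucc a]oadd0 -oaddS.
exact/oadd_ler/osucc_le.
Qed.

(** Step [i] of the construction picks an index [p i] beyond the earlier ones,
    containing the [i]-th point if possible.  If it is impossible, no index of
    that point exceeds all the earlier choices, and these are bounded in [M] by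
    cofinality. *)
Lemma exists_selector : exists p : Ord -> Ord,
  [/\ forall i j, i < j -> j < k -> p i < p j,
      forall i, i < k -> p i < M &
      forall i, i < k -> ~ O (p i) (e i) ->
        exists2 B, B < M & forall d, d < M -> O d (e i) -> d <= B].
Proof.
pose ok (S : set Ord) a := a < M /\ forall b, S b -> b < a.
have [|p pP] := @transfinite_choice Ord k (fun i S a => ok S a /\
   (O a (e i) \/ forall a', ok S a' -> ~ O a' (e i))) 0.
  move=> f n nk fP.
  have [[a [aok Oa]]|na] := pselect (exists a, ok (f @` below n) a /\ O a (e n)).
    by exists a; split=> //; left.
  have [|B BM fB] := cofM (f := f) nk; first by move=> d /fP[[]].
  exists (osucc B); split; last by right=> a' ok' Oa'; apply: na; exists a'.
  by split=> [|_ [d dn <-]]; [apply: addMS|apply/osuccP/fB].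
exists p; split.
- by move=> i j ij jk; have [[_ h] _] := pP _ jk; apply: h; exists i.
- by move=> i ik; have [[]] := pP _ ik.
move=> i ik nO; have [|B BM pB] := cofM (f := p) ik.
  by move=> d di; have [[]] := pP _ (lt_trans di ik).
exists B => // d dM Od; have [_ [//|/(_ d) h]] := pP _ ik.
rewrite leNgt; apply/negP => Bd; apply: h => //; split=> // _ [b bi <-].
by apply: le_lt_trans Bd; apply: pB.
Qed.

(** The indices up to [B], those in the range of [p] and those from [M] on have
    together a type at most [osucc B + k + c < M]. *)
Lemma small_not_cover (p : Ord -> Ord) (B : Ord) :
  (forall i j, i < j -> j < k -> p i < p j) -> (forall i, i < k -> p i < M) ->
  B < M -> exists x, forall d, d < M + c -> O d x ->
    [/\ B < d, d < M & forall i, i < k -> d <> p i].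
Proof.
move=> pinc pM BM.
(* [place d v] puts the three kinds of indices into consecutive intervals of
   lengths [osucc B], [k] and [c]. *)
pose lo d v := d <= B /\ v = d.
pose mid d v := B < d /\ exists2 i, i < k & d = p i /\ v = osucc B + i.
pose hi d v := exists2 b, b < c & d = M + b /\ v = osucc B + k + b.
pose place d v := [\/ lo d v, mid d v | hi d v].
pose H := [set d | exists v, place d v].
have /choice[f fP] d : exists v, H d -> place d v.
  by have [[v dv]|] := pselect (H d); [exists v|exists 0].
have mid_lt d v : mid d v -> d < M /\ v < osucc B + k.
  by move=> [_ [i ik [-> ->]]]; split; [apply: pM|apply: oadd_ltr].
have hi_ge d v : hi d v -> M <= d /\ osucc B + k <= v.
  by move=> [b _ [-> ->]]; split; apply: oaddl_le.
have HMc : H `<=` below (M + c).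
  move=> d [v [[dB _]|/mid_lt[dM _]|[b bc [-> _]]]]; last exact: oadd_ltr.
    exact: le_lt_trans dB (lt_le_trans BM (oaddl_le _ _)).
  exact: lt_le_trans dM (oaddl_le _ _).
have [//|x y Hx Hy xy|x Hx|g gle Hg] := @order_type_le H (M + c) (osucc B + k + c) f.
- have := fP _ Hy; have := fP _ Hx; rewrite /place.
  move=> [[xB ->]|mx|hx] [[yB ->]|my|hy] //.
  + by case: my => By [i ik [_ ->]]; apply: le_lt_trans xB _;
      apply: lt_le_trans (ltOrdS B) (oaddl_le _ _).
  + have [_] := hi_ge _ _ hy; apply: lt_le_trans.
    exact: le_lt_trans xB (lt_le_trans (ltOrdS B) (oaddl_le _ _)).
  + by case: mx => Bx _; have := lt_trans Bx xy; rewrite ltNge yB.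
  + move: mx my => [_ [i ik [xE ->]]] [_ [j jk [yE ->]]]; apply: oadd_ltr.
    case: (ltgtP i j) => // [ji|ij]; move: xy; rewrite xE yE; last by rewrite ij ltxx.
    by move=> /(lt_trans (pinc _ _ ji ik)); rewrite ltxx.
  + have [_ h1] := mid_lt _ _ mx; have [_ h2] := hi_ge _ _ hy.
    exact: lt_le_trans h1 h2.
  + have [Mx _] := hi_ge _ _ hx; have := le_lt_trans Mx xy.
    by rewrite ltNge => /negP[]; apply: le_trans yB (ltW BM).
  + have [Mx _] := hi_ge _ _ hx; have [yM _] := mid_lt _ _ my.
    by have := lt_trans (le_lt_trans Mx xy) yM; rewrite ltxx.
  + move: hx hy xy => [b bc [-> ->]] [b' b'c [-> ->]].
    by rewrite !oadd_ltrE.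
- case: (fP _ Hx) => [[xB ->]|/mid_lt[_ h]|[b bc [_ ->]]].
  + apply: le_lt_trans xB (lt_le_trans (ltOrdS B) _).
    by rewrite -oaddA; apply: oaddl_le.
  + exact: lt_le_trans h (oaddl_le _ _).
  + exact: oadd_ltr.
have /existsNP[x nx] := nsub HMc (le_lt_trans gle (addM (addMS BM))) Hg.
have notH d : O d x -> ~ H d by move=> Od Hd; apply: nx; exists d.
exists x => d dMc /notH nH; split.
- by rewrite ltNge; apply/negP => dB; apply: nH; exists d; constructor 1.
- case/oaddP: dMc => // -[b bc dE]; case: nH; exists (osucc B + k + b).
  by constructor 3; exists b.
- move=> i ik dE; apply: nH; have [dB|Bd] := leP d B.
    by exists d; constructor 1.
  by exists (osucc B + i); constructor 2; split=> //; exists i.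
Qed.

(** Each new point is taken outside all sets whose index is at most the bound [bd]
    of some earlier point, or is in the range of [p], or is at least [M].  A
    point avoiding the last two kinds has bounded index set by the property of
    the selector [p], so that [bd] exists. *)
Lemma scattered_points : exists x : Ord -> X,
  forall i j d, i < k -> j < k -> d < M + c -> O d (x i) -> O d (x j) -> i = j.
Proof.
have [p [pinc pM pO]] := exists_selector.
pose good x := forall d, d < M + c -> O d x -> d < M /\ forall i, i < k -> d <> p i.
have /choice[bd bdP] x : exists B, good x ->
    B < M /\ forall d, d < M + c -> O d x -> d <= B.
  have [gx|] := pselect (good x); last by exists 0.
  have [i ik ei] := e_surj x.
  have nO : ~ O (p i) (e i).
    rewrite ei => Op.
    by have [_ /(_ i ik)] := gx _ (lt_le_trans (pM _ ik) (oaddl_le _ _)) Op.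
  have [B BM h] := pO _ ik nO; exists B => _; split=> // d dMc Od.
  by have [dM _] := gx _ dMc Od; apply: h => //; rewrite ei.
have [|x xP] := @transfinite_choice X k (fun _ S y => good y /\
   forall z d, S z -> d <= bd z -> ~ O d y) (e 0).
  move=> f n nk fP; have [|B BM fB] := cofM (f := bd \o f) nk.
    by move=> d dn /=; have [/bdP[]] := fP _ dn.
  have [y yP] := small_not_cover pinc pM BM; exists y; split.
    by move=> d dMc Od; have [] := yP _ dMc Od.
  move=> z d [i ik <-] le Od.
  have le' : d <= B by apply: le_trans le (fB _ _).
  have [|] := yP d _ Od; last by rewrite ltNge le'.
  exact: le_lt_trans le' (lt_le_trans BM (oaddl_le _ _)).
exists x.
have nlt i j d : i < j -> j < k -> d < M + c -> O d (x i) -> ~ O d (x j).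
  move=> ij jk dMc Oi; have [_ h] := xP _ jk; apply: (h (x i)); first by exists i.
  by have [/bdP[_ h'] _] := xP _ (lt_trans ij jk); apply: h'.
move=> i j d ik jk dMc Oi Oj; case: (ltgtP i j) => // ij.
- by case: (nlt i j d).
- by case: (nlt j i d).
Qed.

End Scattered.

(** * Lindelof ordinals *)

Lemma enumeration (X : Type) (k : Ord) : [set: X] !=set0 ->
  [set: X] #= below k -> exists (r : X -> Ord) (e : Ord -> X),
    [/\ forall x, r x < k, injective r & forall x, exists2 i, i < k & e i = x].
Proof.
move=> [x0 _] /card_bijP[f [g fK gK]].
pose s x : [set: X] := SigSub (mem_set (I : [set: X] x)).
pose r x := val (f (s x)).
have rk x : r x < k by have := valP (f (s x)); rewrite inE.
have rinj : injective r.
  by move=> x y /val_inj/(can_inj fK)/(congr1 val).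
have /choice[e eP] i : exists x, forall y, r y = i -> y = x.
  have [[y <-]|n] := pselect (exists y, r y = i); first by exists y => z /rinj.
  by exists x0 => y yi; case: n; exists y.
by exists r, e; split=> // x; exists (r x) => //; rewrite -(eP _ x).
Qed.

Lemma lindelof_not_embeds (X : Type) (tau : set (set X)) (k M c a : Ord)
    (O : Ord -> set X) :
  [set: X] !=set0 -> [set: X] #= below k -> 0 < k -> cof_ge k M ->
  (forall b, b < M -> b + k + c < M) -> a = M + c ->
  (forall d, d < a -> tau (O d)) -> covers O (below a) ->
  (forall H g, H `<=` below a -> g < a -> has_order_type H g -> ~ covers O H) ->
  ~ embeds (lindelof_ordinal tau) k.
Proof.
move=> X0 Xk k0 cM addM -> tauO Ocov nsub Lk.
have [r [e [_ _ eS]]] := enumeration X0 Xk.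
have [L0 Lc _] := lindelof_ordinalP tau.
have [|x xP] := @scattered_points X k M c O e k0 eS cM addM.
  by move=> H g Hs gM; apply: nsub => //; apply: lt_le_trans gM (oaddl_le _ _).
exact: not_ocompact_of_scattered L0 Lk tauO Ocov xP Lc.
Qed.

Lemma least_subcover_embeds (X : Type) (k a : Ord) (O : Ord -> set X) :
  [set: X] !=set0 -> [set: X] #= below k -> covers O (below a) ->
  (forall H g, H `<=` below a -> g < a -> has_order_type H g -> ~ covers O H) ->
  embeds a k.
Proof.
move=> X0 Xk Ocov nsub.
have [r [e [rk rinj _]]] := enumeration X0 Xk.
have [j jinj] := least_subcover_inj Ocov nsub X0.
by exists (r \o j); split=> [x _|x y xa ya /rinj]; [apply: rk|apply: jinj].
Qed.

Lemma embeds_omega (a : Ord) : embeds a omega <-> countable (below a).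
Proof.
split=> [[j [jw jinj]]|/countable_injP[f finj]].
  have /choice[n nP] x : exists n : nat, x < a -> j x = iter n osucc 0.
    have [/jw/omegaE[n jn]|] := pselect (x < a); first by exists n.
    by exists 0%N.
  apply/countable_injP; exists n => x y /set_mem xa /set_mem ya e.
  by apply: jinj => //; rewrite !nP // e.
exists (fun x => iter (f x) osucc 0); split=> [x _|x y xa ya]; first exact: omega_gt.
have n0 : ~ is_succ 0 by move=> [b b0]; have := ltOrdS b; rewrite -b0 => /nlt0.
by move=> /(iter_osucc_inj n0 n0)[/finj + _]; apply; apply: mem_set.
Qed.

Theorem corollary4p8 (X : Type) (tau : set (set X))
    (X_nonempty : [set: X] !=set0) (tau_nonempty : tau !=set0) :
  ([set: X] #= below omega ->
     lindelof_ordinal tau = omega1 \/ lindelof_ordinal tau <= omega * omega) /\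
  (forall kappa : Ord, infinite_regular_cardinal kappa ->
     [set: X] #= below kappa ->
   forall alpha1 epsilon gamma : Ord,
     0 <= alpha1 ->
     0 < gamma -> gamma < kappa * omega ->
     1 < epsilon -> is_succ epsilon \/ cf epsilon = kappa ->
     lindelof_ordinal tau <> alpha1 + kappa ^ epsilon + gamma).
Proof.
have [_ Lc Lmin] := lindelof_ordinalP tau; split.
- move=> Xw; have w0 : 0 < omega := omega_gt 0.
  have [->|nL1] := pselect (lindelof_ordinal tau = omega1); [by left|right].
  have [nc1 c1] := omega1P.
  have L1 : lindelof_ordinal tau < omega1.
    rewrite lt_neqAle; apply/andP; split; first exact/eqP.
    apply: Lmin.
      apply/gt0 => e; apply: nc1; apply/countable_injP; exists (fun=> 0%N).
      by move=> x y /set_mem; rewrite /= e => /nlt0.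
    apply: contrapT => /least_subcover[a [O [le1 _ Ocov nsub]]]; apply: nc1.
    by apply/embeds_omega/(embeds_le le1)/(least_subcover_embeds _ Xw Ocov).
  have ww : closed_add omega (omega * omega).
    exact: closed_add_omul w0 omega_limit (lexx _).
  rewrite leNgt; apply/negP => wL.
  have ww0 : 0 < omega * omega.
    by rewrite -[0](omul0 omega); apply: omul_ltr.
  have /least_subcover[a [O [wa tauO Ocov nsub]]] : ~ ocompact_infty tau (omega * omega).
    by move=> /(Lmin _ ww0); rewrite leNgt wL.
  (* Minimality of [m] discards the tail of type below [omega * omega]. *)
  have [|[c cw aE] mmin] := @oleastP [set m | exists2 c, c < omega * omega & a = m + c].
    by exists a, 0 => //; rewrite oadd0.
  set m := oleast _ in aE mmin.
  have m0 : 0 < m.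
    by apply/gt0 => m0; move: wa; rewrite aE m0 oadd0l leNgt cw.
  apply: (lindelof_not_embeds X_nonempty Xw w0 _ _ aE tauO Ocov nsub).
  + exact: cof_ge_omega.
  + move=> b bm; have [t mE] := osub (ltW bm).
    rewrite -oaddA {1}mE oadd_ltr //.
    apply: (@lt_le_trans _ _ (omega * omega)).
      apply: (closed_add_lt ww) => //.
      by rewrite -{1}[omega]omulr1; apply: omul_ltr => //; apply: (omega_gt 1).
    (* A tail [t] of [m] below [omega * omega] could be absorbed in [c]. *)
    rewrite leNgt; apply/negP => tw; move: bm; rewrite ltNge => /negP; apply.
    apply: mmin; exists (t + c); first exact: closed_add_lt ww tw cw.
    by rewrite oaddA -mE.
  + by apply/embeds_omega/c1.
- move=> k reg Xk a1 e c _ c0 ckw e1 eP LE.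
  have k0 : 0 < k := lt_trans (ltOrdS 0) (regular_gt1 reg).
  have ke0 : 0 < k ^ e by apply: oexp_gt0.
  set M := a1 + k ^ e in LE.
  have ML : M < lindelof_ordinal tau by rewrite LE -{1}[M]oadd0 oadd_ltr.
  have M0 : 0 < M by apply: le_lt_trans (ole0 a1) _; rewrite -{1}[a1]oadd0 oadd_ltr.
  have /least_subcover[a [O [Ma tauO Ocov nsub]]] : ~ ocompact_infty tau M.
    by move=> /(Lmin _ M0); rewrite leNgt ML.
  have aL : a < lindelof_ordinal tau.
    rewrite ltNge; apply/negP => La; have [|H [Ha [g gL Hg] Hc]] := Lc a La O tauO.
      exact/coversP.
    by apply: (nsub H g) => //; [apply: lt_le_trans La|apply/coversP].
  have kM : closed_add k M by apply: closed_add_oadd (closed_add_oexp _ _).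
  have [c' aE] := osub Ma.
  have c'c : c' < c by rewrite -(oadd_ltrE M) -aE -LE.
  apply: (lindelof_not_embeds X_nonempty Xk k0 _ _ aE tauO Ocov nsub).
  + by apply: cof_ge_oadd => //; apply: cof_ge_oexp.
  + move=> b bM; apply: (closed_add_lt kM); [exact: kM|exact: lt_trans ckw].
  + rewrite LE; apply: embeds_oadd_lt ckw; first exact: regular_limit.
    by apply: embeds_le Ma _; apply: least_subcover_embeds Ocov nsub.
Qed.
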